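(* Let $X_1\subseteq\cdots\subseteq X_L$ be nested point sets. With $N_0:=0$ and $A_0(f):=0$, the multilevel approximation at level $L$ to $f\in C(\Omega)$ can be written as $$A_L(f)=\sum_{\ell=1}^L\sum_{i=N_{\ell-1}+1}^{N_\ell}\left[f(\boldsymbol{x}_i)-A_{\ell-1}f(\boldsymbol{x}_i)\right]\chi_i^{(\ell)}.$$ Consequently, the approximation space $\widetilde V_L=A_L(C(\Omega))$ is recursively given by $$\widetilde V_L=\begin{cases}\operatorname{span}\{\chi_i^{(1)}:1\le i\le N_1\}&\text{if }L=1,\\ \widetilde V_{L-1}\oplus\operatorname{span}\{\chi_i^{(L)}:N_{L-1}+1\le i\le N_L\}&\text{if }L\ge2,\end{cases}$$ where the sum is direct.
   Context: Let $\Omega\subseteq\mathbb{R}^d$ be a bounded domain and $X_1\subseteq X_2\subseteq\cdots\subseteq X_L\subseteq\Omega$ nested finite point sets, ordered so that $X_\ell=\{\boldsymbol{x}_1,\ldots,\boldsymbol{x}_{N_\ell}\}$ (distinct points) for $1\le\ell\le L$. Their fill distances $h_\ell=\sup_{\boldsymbol{x}\in\Omega}\min_{1\le i\le N_\ell}\|\boldsymbol{x}-\boldsymbol{x}_i\|_2$ satisfy $c\mu h_\ell\le h_{\ell+1}\le\mu h_\ell$ with fixed $\mu\in(0,1)$, $c\in(0,1]$. Let $\Phi:\mathbb{R}^d\to\mathbb{R}$ be a positive definite radial basis function (continuous, with all matrices $(\Phi(\boldsymbol{y}_i-\boldsymbol{y}_j))_{i,j}$ for distinct points positive definite) with support in the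 closed unit ball, and let $\Phi_\ell=\delta_\ell^{-d}\Phi(\cdot/\delta_\ell)$ with $\delta_\ell=\nu h_\ell$ and a fixed $\nu>1$. Let $W_\ell=\operatorname{span}\{\Phi_\ell(\cdot-\boldsymbol{x}_i):1\le i\le N_\ell\}$, and let $\chi_i^{(\ell)}\in W_\ell$, $1\le i\le N_\ell$, be the Lagrange (cardinal) functions, i.e. the unique elements of $W_\ell$ with $\chi_i^{(\ell)}(\boldsymbol{x}_j)=\delta_{ij}$ for $1\le j\le N_\ell$. The interpolation operator is $I_{X_\ell,\Phi_\ell}(g)=\sum_{i=1}^{N_\ell}g(\boldsymbol{x}_i)\chi_i^{(\ell)}$ for $g\in C(\Omega)$. For $f\in C(\Omega)$ put $e_0=f$ and, for $k\ge1$, $s_k=I_{X_k,\Phi_k}(e_{k-1})$, $e_k=e_{k-1}-s_k$; the multilevel operators are $A_\ell(f)=\sum_{k=1}^\ell s_k$ for $1\le\ell\le L$, and $\widetilde V_\ell:=A_\ell(C(\Omega))$. *)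

(* Defs.v *)
From HB Require Import structures.
From mathcomp Require Import all_boot all_order all_algebra.
From mathcomp Require Import all_classical all_reals all_analysis.

Set Implicit Arguments.
Unset Strict Implicit.
Unset Printing Implicit Defensive.

Import Order.TTheory GRing.Theory Num.Theory.
Import numFieldNormedType.Exports.

Local Open Scope classical_set_scope.
Local Open Scope ring_scope.

(* The library norm on row vectors is the sup norm. *)
Definition enorm (R : realType) (d : nat) (v : 'rV[R]_d) : R :=
  Num.sqrt (\sum_(j < d) v 0 j ^+ 2).

(* [X] is meant to be finite and nonempty, so that [inf] is a minimum; the
   outer [sup] is that of a bounded set as soon as [Omega] is bounded. *)
Definition fill_distance (R : realType) (d : nat) (Omega : set 'rV[R]_d)
    (X : set Omega) : R :=
  sup [set inf [set enorm (set_val y - set_val z) | z in X] | y in [set: Omega]].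

Definition posdefmx (R : realType) (n : nat) (A : 'M[R]_n) : Prop :=
  A^T = A /\ forall c : 'cV[R]_n, c != 0 -> 0 < (c^T *m A *m c) 0 0.

Definition positive_definite (R : realType) (d : nat) (Phi : 'rV[R]_d -> R) :
    Prop :=
  forall (n : nat) (y : 'I_n -> 'rV[R]_d), injective y ->
    posdefmx (\matrix_(i, j) Phi (y i - y j)).

Definition radial (R : realType) (d : nat) (Phi : 'rV[R]_d -> R) : Prop :=
  exists phi : R -> R, forall y, Phi y = phi (enorm y).

Definition scaled_kernel (R : realType) (d : nat) (Phi : 'rV[R]_d -> R) (delta : R) :
    'rV[R]_d -> R :=
  fun y => delta ^- d * Phi (delta^-1 *: y).

Definition lin_span (R : realType) (V : lmodType R) (b : nat -> V)
    (m n : nat) : set V :=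
  [set v | exists a : nat -> R, v = \sum_(m <= i < n) a i *: b i].

Definition is_direct_sum (R : realType) (V : lmodType R) (W U1 U2 : set V) :
    Prop :=
  [/\ submod_closed (mem U1), submod_closed (mem U2),
      W = [set u1 + u2 | u1 in U1 & u2 in U2] & U1 `&` U2 = [set 0]].

Section Multilevel.
Context (R : realType) (d : nat) (Omega : set 'rV[R]_d).

(* Points are numbered from 0: x_1, ..., x_n is [x 0], ..., [x n.-1]; values of
   [x] at larger indices are irrelevant. *)
Definition point_set (x : nat -> Omega) (n : nat) : set Omega := x @` `I_n.

(* The spaces consist of functions on [Omega], not on the whole of R^d. *)
Definition translate (K : 'rV[R]_d -> R) (z : Omega) : Omega -> R :=
  fun y => K (set_val y - set_val z).

Definition trial_space (K : 'rV[R]_d -> R) (x : nat -> Omega) (n : nat) :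
    set (Omega -> R) :=
  lin_span (fun i => translate K (x i)) 0 n.

(* The element of the trial space with the cardinality property; it exists and
   is unique for positive definite [K], distinct points and [i < n]. *)
Definition cardinal_fun (K : 'rV[R]_d -> R) (x : nat -> Omega) (n i : nat) :
    Omega -> R :=
  xget 0 [set g | trial_space K x n g /\
                  forall j, (j < n)%N -> g (x j) = (i == j)%:R].

Definition interpolant (K : 'rV[R]_d -> R) (x : nat -> Omega) (n : nat)
    (g : Omega -> R) : Omega -> R :=
  \sum_(0 <= i < n) g (x i) *: cardinal_fun K x n i.

(* [K l] is the kernel and [N l] the number of points at level [l >= 1]. *)
Fixpoint ml_error (K : nat -> 'rV[R]_d -> R) (x : nat -> Omega)
    (N : nat -> nat) (f : Omega -> R) (l : nat) : Omega -> R :=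
  if l is k.+1 then
    let e := ml_error K x N f k in e - interpolant (K l) x (N l) e
  else f.

Definition ml_approx (K : nat -> 'rV[R]_d -> R) (x : nat -> Omega)
    (N : nat -> nat) (l : nat) (f : Omega -> R) : Omega -> R :=
  \sum_(1 <= k < l.+1) interpolant (K k) x (N k) (ml_error K x N f k.-1).

Definition ml_space (K : nat -> 'rV[R]_d -> R) (x : nat -> Omega)
    (N : nat -> nat) (l : nat) : set (Omega -> R) :=
  ml_approx K x N l @` [set f : Omega -> R | continuous f].

Definition level_kernel (Phi : 'rV[R]_d -> R) (nu : R) (x : nat -> Omega)
    (N : nat -> nat) (l : nat) : 'rV[R]_d -> R :=
  scaled_kernel Phi (nu * fill_distance (point_set x (N l))).

End Multilevel.

(* Main.v *)
Require Import Defs.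
From HB Require Import structures.
From mathcomp Require Import all_boot all_order all_algebra.
From mathcomp Require Import all_classical all_reals all_analysis.

Set Implicit Arguments.
Unset Strict Implicit.
Unset Printing Implicit Defensive.

Import Order.TTheory GRing.Theory Num.Theory.
Import numFieldNormedType.Exports.

Local Open Scope classical_set_scope.
Local Open Scope ring_scope.

(** The interpolant of [g] depends only on the values of [g] at the nodes, and
    it takes these values there.  The residual [f - A l f] equals the error
    after [l] steps ([ml_errorE]), so it vanishes on the first [N l] points
    ([ml_approx_interpolates]).  Hence in the correction computed at level
    [l.+1], which interpolates this residual, only the cardinal functions of
    the new points [N l <= i < N l.+1] survive ([ml_approx_increment]), and
    summing the corrections over the levels gives the expansion of [A L f].

    The direct sum rests on two further facts.  First, [A l f] depends only on
    the values of [f] at the first [N l] points ([ml_approx_local]).  Second,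
    every combination [v] of the new cardinal functions of level [l.+1] vanishes
    at these points ([detail_vanishes]).  Thus a function [g = A l f + v] agrees
    with [f] at the points of level [l], so [A l g = A l f]; its residual at the
    new points recovers the coefficients of [v], and [A l.+1 g = g]
    ([ml_approx_reproduces]).  Since the cardinal functions are continuous, [g]
    is an admissible argument, which gives the inclusion of the sum in the
    space of level [l.+1].  For the intersection: if [A l f] is such a [v], then
    [f], like [v], vanishes at the points of level [l], and locality gives
    [A l f = A l 0 = 0].  The formula for one level is the case [l = 0], as the
    space of level 0 is zero.

    All this needs cardinal functions at every level, that is, invertible kernel
    matrices.  Scaling by [delta] preserves positive definiteness for
    [delta > 0], and [delta] is positive because the fill distance is
    ([fill_distance_gt0]): a nonempty open subset of a space of positive
    dimension is never exhausted by finitely many points. *)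

(** * Positivity of the fill distance *)

Lemma enorm_ge0 (R : realType) (d : nat) (v : 'rV[R]_d) : 0 <= enorm v.
Proof. exact: sqrtr_ge0. Qed.

Lemma enorm_gt0 (R : realType) (d : nat) (v : 'rV[R]_d) :
  v != 0 -> 0 < enorm v.
Proof.
move=> v0; rewrite sqrtr_gt0 lt0r sumr_ge0 ?andbT; last first.
  by move=> j _; rewrite sqr_ge0.
apply: contra v0 => /eqP/psumr_eq0P v0; apply/eqP/rowP => j.
by rewrite mxE; apply/eqP; rewrite -sqrf_eq0 v0 // => k _; rewrite sqr_ge0.
Qed.

Lemma norm_coord_le (R : realType) (d : nat) (v : 'rV[R]_d) (j : 'I_d) :
  `|v 0 j| <= `|v|.
Proof.
rewrite /Num.Def.normr /= mx_normrE.
exact: (le_bigmax _ (fun ij : 'I_1 * 'I_d => `|v ij.1 ij.2|) (0, j)).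
Qed.

(** Squares of absolute values are among the terms of the expanded square of
    the sum.  This crude bound is enough to see that distances in a bounded
    set are bounded. *)
Lemma enorm_le_sum (R : realType) (d : nat) (v : 'rV[R]_d) :
  enorm v <= \sum_(j < d) `|v 0 j|.
Proof.
have s0 : 0 <= \sum_(j < d) `|v 0 j| by rewrite sumr_ge0.
rewrite -(ler_pXn2r (isT : (0 < 2)%N)) ?nnegrE ?enorm_ge0 //.
rewrite sqr_sqrtr ?sumr_ge0 // => [|j _]; last by rewrite sqr_ge0.
rewrite expr2 mulr_suml; apply: ler_sum => j _.
rewrite -real_normK ?num_real // expr2 ler_wpM2l //.
by rewrite (bigD1 j) //= lerDl sumr_ge0.
Qed.

Lemma avoid_finitely_many (R : realType) (t : nat -> R) (n : nat) (e : R) :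
  0 < e -> exists2 s, 0 < s < e & forall i, (i < n)%N -> s != t i.
Proof.
move=> e0.
(* For the induction, [s] has to lie below every positive [t i], so that it can
   be decreased further without meeting the values already avoided. *)
suff [s se st] : exists2 s, 0 < s < e &
    forall i, (i < n)%N -> t i <= 0 \/ s < t i.
  exists s => // i /st[ti0|]; last by move=> /lt_eqF ->.
  by rewrite gt_eqF // (le_lt_trans ti0) //; case/andP: se.
elim: n => [|n [s /andP[s0 se] st]].
  by exists (e / 2) => //; rewrite divr_gt0 //= ltr_pdivrMr // ltr_pMr // ltr1n.
have [tn0|tn0] := leP (t n) 0.
  exists s; rewrite ?s0 // => i; rewrite ltnS leq_eqVlt => /orP[/eqP->|/st//].
  by left.
exists (Num.min s (t n / 2)).
  by rewrite lt_min s0 divr_gt0 //= gt_min se.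
move=> i; rewrite ltnS leq_eqVlt => /orP[/eqP->|/st[]]; [right|by left|right].
  by rewrite gt_min ltr_pdivrMr // ltr_pMr // ltr1n orbT.
by rewrite gt_min b.
Qed.

(** A short segment issued from a point of [Omega] in the direction of the
    all-ones vector stays in [Omega]; comparing one coordinate shows that each
    [z i] excludes at most one parameter value on it. *)
Lemma open_avoids_finitely_many (R : realType) (d : nat) (Omega : set 'rV[R]_d)
    (z : nat -> 'rV[R]_d) (n : nat) :
  (0 < d)%N -> open Omega -> Omega !=set0 ->
  exists2 y, Omega y & forall i, (i < n)%N -> y != z i.
Proof.
move=> d0 oO [p Op].
pose g (s : R) : 'rV[R]_d := p + s *: const_mx 1.
have gc : continuous g.
  move=> s; apply: cvgD; first exact: cvg_cst.
  by apply: cvgZr_tmp; exact: cvg_id.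
have : nbhs (0 : R) (g @^-1` Omega).
  by apply: gc; rewrite /g scale0r addr0; exact: open_nbhs_nbhs.
case/nbhs_ballP => e /= e0 eO.
pose j0 := Ordinal d0.
have [s /andP[s0 se] st] :=
  avoid_finitely_many (fun i => (z i - p) 0 j0) n e0.
exists (g s).
  by apply: eO; rewrite /ball /= sub0r normrN gtr0_norm.
move=> i /st; apply: contra => /eqP <-.
by rewrite /g !mxE mulr1 addrC addKr.
Qed.

(** The supremum is at least the distance to the nodes of a point of [Omega]
    that is not a node.  Boundedness of [Omega] matters because [sup] is only
    meaningful for a set that has an upper bound. *)
Lemma fill_distance_gt0 (R : realType) (d : nat) (Omega : set 'rV[R]_d)
    (x : nat -> Omega) (n : nat) :
  (0 < d)%N -> open Omega -> Omega !=set0 -> bounded_set Omega ->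
  (0 < n)%N -> 0 < fill_distance (point_set x n).
Proof.
move=> d0 oO O0 bO n0.
have [y Oy yx] := open_avoids_finitely_many (fun i => set_val (x i)) n d0 oO O0.
have [e e0 ey] : exists2 e, 0 < e &
    forall i, (i < n)%N -> e <= enorm (y - set_val (x i)).
  elim: n yx {n0} => [|n IH] yx; first by exists 1.
  have [|e e0 ee] := IH; first by move=> i /ltnW; exact: yx.
  exists (Num.min e (enorm (y - set_val (x n)))).
    by rewrite lt_min e0 enorm_gt0 // subr_eq0 yx.
  move=> i; rewrite ltnS leq_eqVlt => /orP[/eqP->|/ee h].
    by rewrite ge_min lexx orbT.
  by rewrite ge_min h.
pose S (y : Omega) :=
  [set enorm (set_val y - set_val z) | z in point_set x n].
have S0 w : S w (enorm (set_val w - set_val (x 0%N))).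
  by exists (x 0%N) => //; exists 0%N.
have Slb w : has_lbound (S w).
  by exists 0 => _ [z _ <-]; exact: enorm_ge0.
apply: (@lt_le_trans _ _ (inf (S (SigSub (mem_set Oy))))).
  apply: (lt_le_trans e0); apply: lb_le_inf; first by eexists; exact: S0.
  by move=> _ [_ [i /= ni <-] <-]; exact: ey.
apply: ub_le_sup; last by exists (SigSub (mem_set Oy)).
have [M [_ /(_ (M + 1))]] := bO; rewrite ltrDl ltr01 => /(_ isT) MO.
exists (\sum_(j < d) ((M + 1) + (M + 1))) => _ [w _ <-].
apply: (le_trans (ge_inf (Slb w) (S0 w))).
apply: (le_trans (enorm_le_sum _)); apply: ler_sum => j _.
apply: (le_trans (norm_coord_le _ _)); apply: (le_trans (ler_normB _ _)).
by apply: lerD; apply: MO; exact: set_valP.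
Qed.

(** * Cardinal functions of positive definite kernels *)

Lemma posdefmx_unit (R : realType) (n : nat) (A : 'M[R]_n) :
  posdefmx A -> A \in unitmx.
Proof.
move=> [_ Apos]; rewrite -row_free_unit; apply: inj_row_free => v vA.
apply/eqP; apply: contraT => v0.
have /Apos : v^T != 0 by rewrite -(inj_eq (@trmx_inj _ _ _)) trmxK trmx0.
by rewrite trmxK vA mul0mx mxE ltxx.
Qed.

Lemma positive_definite_scaled (R : realType) (d : nat) (Phi : 'rV[R]_d -> R)
    (delta : R) :
  0 < delta -> positive_definite Phi ->
  positive_definite (scaled_kernel Phi delta).
Proof.
move=> delta0 Phipd n y yinj.
have [] := Phipd n (fun i => delta^-1 *: y i).
  by move=> i j /(scalerI (invr_neq0 (lt0r_neq0 delta0))) /yinj.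
set B := (\matrix_(i, j) _) => BT Bpos.
have -> : \matrix_(i, j) scaled_kernel Phi delta (y i - y j) = delta ^- d *: B.
  by apply/matrixP => i j; rewrite !mxE /scaled_kernel scalerBr.
split=> [|c /Bpos cBc]; first by rewrite linearZ /= BT.
by rewrite -scalemxAr -scalemxAl mxE mulr_gt0 // invr_gt0 exprn_gt0.
Qed.

Lemma continuous_fct_lin (R : realType) (T : topologicalType) (a : R)
    (f g : T -> R) : continuous f -> continuous g -> continuous (a *: f + g).
Proof.
move=> fc gc t.
have af : {for t, continuous (a *: f)}.
  exact: (continuousM (@cst_continuous _ _ a t) (fc t)).
exact: (continuousD af (gc t)).
Qed.

Lemma continuous_fct_sum (R : realType) (T : topologicalType) (r : seq nat)
    (a : nat -> R) (b : nat -> T -> R) :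
  (forall i, i \in r -> continuous (b i)) ->
  continuous (\sum_(i <- r) a i *: b i).
Proof.
elim: r => [|i r IH] bc; first by rewrite big_nil; exact: cst_continuous.
rewrite big_cons; apply: continuous_fct_lin.
  by apply: bc; rewrite mem_head.
by apply: IH => k kr; apply: bc; rewrite in_cons kr orbT.
Qed.

Lemma continuous_shift (R : realType) (d : nat) (K : 'rV[R]_d -> R)
    (z : 'rV[R]_d) : continuous K -> continuous (fun y : 'rV[R]_d => K (y - z)).
Proof.
move=> Kc y; have yz : {for y, continuous (fun y : 'rV[R]_d => y - z)}.
  by apply: (@continuousB _ 'rV[R]_d 'rV[R]_d id (cst z));
    [exact: cvg_id|exact: cst_continuous].
exact: (continuous_comp yz (Kc _)).
Qed.

Section Cardinal.
Context (R : realType) (d : nat) (Omega : set 'rV[R]_d).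
Context (K : 'rV[R]_d -> R) (x : nat -> Omega) (n : nat).
Context (Kpd : positive_definite K) (xinj : {in `I_n &, injective x}).

(** The coefficients of the [i]-th cardinal function in the basis of translates
    form the [i]-th column of the inverse of the kernel matrix. *)
Lemma cardinal_fun_spec (i : nat) : (i < n)%N ->
  trial_space K x n (cardinal_fun K x n i) /\
  forall j, (j < n)%N -> cardinal_fun K x n i (x j) = (i == j)%:R.
Proof.
move=> ni.
suff ex : exists g, trial_space K x n g /\
    forall j, (j < n)%N -> g (x j) = (i == j)%:R by exact: (xgetPex 0 ex).
pose M := \matrix_(k < n, j < n) K (set_val (x k) - set_val (x j)).
have Mu : M \in unitmx.
  apply: posdefmx_unit.
  apply: (Kpd (y := fun k : 'I_n => set_val (x k))) => k j /val_inj kj.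
  by apply: val_inj; apply: xinj kj; rewrite inE /=.
pose a (k : nat) : R :=
  if insub k is Some k' then invmx M k' (Ordinal ni) else 0.
exists (\sum_(0 <= k < n) a k *: translate K (x k)); split; first by exists a.
move=> j nj; rewrite fct_sumE big_mkord.
have /matrixP/(_ (Ordinal nj) (Ordinal ni)) := mulmxV Mu.
rewrite !mxE eq_sym -val_eqE /= => <-; apply: eq_bigr => k _.
by rewrite /a valK mxE mulrC.
Qed.

Lemma cardinal_funE (i j : nat) : (i < n)%N -> (j < n)%N ->
  cardinal_fun K x n i (x j) = (i == j)%:R.
Proof. by move=> /cardinal_fun_spec[_ +]; apply. Qed.

Lemma continuous_cardinal_fun (i : nat) : continuous K -> (i < n)%N ->
  continuous (cardinal_fun K x n i).
Proof.
move=> Kc /cardinal_fun_spec[[a ->] _]; apply: continuous_fct_sum => k _ w.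
apply: (@continuous_comp Omega _ _ set_val
  (fun y : 'rV[R]_d => K (y - set_val (x k)))).
  exact: (@initial_continuous Omega _ set_val).
exact: continuous_shift.
Qed.

End Cardinal.

Lemma continuous_scaled_kernel (R : realType) (d : nat) (Phi : 'rV[R]_d -> R)
    (delta : R) : continuous Phi -> continuous (scaled_kernel Phi delta).
Proof.
move=> Phic y.
have yPhi : {for y, continuous (fun y : 'rV[R]_d => Phi (delta^-1 *: y))}.
  exact: (continuous_comp (@scaler_continuous _ 'rV[R]_d delta^-1 y) (Phic _)).
exact: (continuousM (@cst_continuous _ _ (delta ^- d) y) yPhi).
Qed.

(** * The multilevel operator *)

(** Inclusion of the point sets orders the numbers of points: otherwise [x n]
    would coincide with an earlier point. *)
Lemma nested_size_le (R : realType) (d : nat) (Omega : set 'rV[R]_d)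
    (x : nat -> Omega) (m n : nat) :
  {in `I_m &, injective x} -> point_set x m `<=` point_set x n -> (m <= n)%N.
Proof.
move=> xinj mn; rewrite leqNgt; apply/negP => nm.
have [|j /= nj xjn] := mn (x n); first by exists n.
have /eqP := xinj _ _ (mem_set (ltn_trans nj nm : `I_m j)) (mem_set nm) xjn.
by rewrite ltn_eqF.
Qed.

Lemma lin_span_submod_closed (R : realType) (V : lmodType R) (b : nat -> V)
    (m n : nat) : submod_closed (mem (lin_span b m n)).
Proof.
split=> [|c u v]; rewrite !inE.
  by exists (fun=> 0); rewrite big1 // => i _; rewrite scale0r.
move=> [a1 ->] [a2 ->]; exists (fun i => c * a1 i + a2 i).
rewrite scaler_sumr -big_split /=; apply: eq_bigr => i _.
by rewrite scalerDl scalerA.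
Qed.

Section MultilevelOperator.
Context (R : realType) (d : nat) (Omega : set 'rV[R]_d).
Context (K : nat -> 'rV[R]_d -> R) (x : nat -> Omega) (N : nat -> nat).

Local Notation chi l := (cardinal_fun (K l) x (N l)).
Local Notation A := (ml_approx K x N).
Local Notation V := (ml_space K x N).

Lemma interpolant_linear (k : 'rV[R]_d -> R) (n : nat) (a : R)
    (f g : Omega -> R) :
  interpolant k x n (a *: f + g) =
    a *: interpolant k x n f + interpolant k x n g.
Proof.
rewrite /interpolant scaler_sumr -big_split /=; apply: eq_bigr => i _.
by rewrite scalerA -scalerDl.
Qed.

Lemma ml_errorE (f : Omega -> R) (l : nat) : ml_error K x N f l = f - A l f.
Proof.
elim: l => [|l IH]; first by rewrite /ml_approx big_geq // subr0.
have -> : A l.+1 f =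
    A l f + interpolant (K l.+1) x (N l.+1) (ml_error K x N f l).
  by rewrite /ml_approx big_nat_recr.
by rewrite opprD addrA -IH.
Qed.

Lemma ml_approx0 (f : Omega -> R) : A 0 f = 0.
Proof. by rewrite /ml_approx big_geq. Qed.

Lemma ml_approxS (l : nat) (f : Omega -> R) :
  A l.+1 f = A l f + interpolant (K l.+1) x (N l.+1) (f - A l f).
Proof. by rewrite -ml_errorE /ml_approx big_nat_recr. Qed.

Lemma ml_approx_linear (l : nat) (a : R) (f g : Omega -> R) :
  A l (a *: f + g) = a *: A l f + A l g.
Proof.
elim: l => [|l IH]; first by rewrite !ml_approx0 scaler0 addr0.
have -> : A l.+1 (a *: f + g) = (a *: A l f + A l g) +
    interpolant (K l.+1) x (N l.+1) (a *: (f - A l f) + (g - A l g)).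
  by rewrite ml_approxS IH scalerBr opprD addrACA.
by rewrite interpolant_linear !ml_approxS scalerDr addrACA.
Qed.

Lemma ml_approx_at0 (l : nat) : A l 0 = 0.
Proof.
by have := ml_approx_linear l (-1) 0 0; rewrite scaler0 addr0 scaleN1r addNr.
Qed.

Lemma ml_space_submod_closed (l : nat) : submod_closed (mem (V l)).
Proof.
split=> [|a u v]; rewrite !inE.
  by exists 0; [exact: cst_continuous|exact: ml_approx_at0].
move=> [f fc <-] [g gc <-]; exists (a *: f + g); last exact: ml_approx_linear.
by apply: (@continuous_fct_lin _ Omega); [exact: fc|exact: gc].
Qed.

(* From here on, kernels and points enter only through cardinality, the order of
   the numbers of points and, at the end, continuity. *)
Context (L : nat).
Context (chiE : forall l i j, (1 <= l <= L)%N -> (i < N l)%N -> (j < N l)%N ->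
  chi l i (x j) = (i == j)%:R).
Context (N0 : N 0%N = 0%N).
Context (N_le : forall l, (l < L)%N -> (N l <= N l.+1)%N).

Lemma interpolantE (l j : nat) (g : Omega -> R) :
  (1 <= l <= L)%N -> (j < N l)%N -> interpolant (K l) x (N l) g (x j) = g (x j).
Proof.
move=> lL jN; rewrite /interpolant fct_sumE big_mkord (bigD1 (Ordinal jN)) //=.
rewrite big1 => [|i]; last first.
  by rewrite -val_eqE /= scalrfctE chiE // => /negPf ->; rewrite scaler0.
by rewrite addr0 scalrfctE chiE // eqxx /GRing.scale /= mulr1.
Qed.

(** The step to level [l.+1] adds the interpolant of the current residual, so
    it repairs all [N l.+1] values at once, whatever the earlier levels did. *)
Lemma ml_approx_interpolates (l j : nat) (f : Omega -> R) :
  (l <= L)%N -> (j < N l)%N -> A l f (x j) = f (x j).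
Proof.
case: l => [|l] lL; first by rewrite N0.
by move=> jN; rewrite ml_approxS !fctE interpolantE //= addrC subrK.
Qed.

(** The residual of level [l] is zero at the old points, so their cardinal
    functions drop out of the correction. *)
Lemma ml_approx_increment (l : nat) (f : Omega -> R) : (l < L)%N ->
  A l.+1 f = A l f +
    \sum_(N l <= i < N l.+1) (f (x i) - A l f (x i)) *: chi l.+1 i.
Proof.
move=> lL; rewrite ml_approxS /interpolant; congr (_ + _).
rewrite (big_cat_nat (n := N l)) ?N_le //= big_nat big1 ?add0r // => i /= iN.
have -> : (f - A l f) (x i) = 0; last by rewrite scale0r.
by rewrite !fctE ml_approx_interpolates ?subrr // ltnW.
Qed.

Lemma ml_approx_expansion (l : nat) (f : Omega -> R) : (l <= L)%N ->
  A l f = \sum_(1 <= k < l.+1) \sum_(N k.-1 <= i < N k)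
            (f (x i) - A k.-1 f (x i)) *: chi k i.
Proof.
elim: l => [|l IH] lL; first by rewrite ml_approx0 big_geq.
by rewrite big_nat_recr //= -IH ?(ltnW lL) // -ml_approx_increment.
Qed.

(** By the increment formula every coefficient is built from values of the
    argument at the points of the current level, and these sets are nested. *)
Lemma ml_approx_local (l : nat) (f g : Omega -> R) : (l <= L)%N ->
  (forall j, (j < N l)%N -> f (x j) = g (x j)) -> A l f = A l g.
Proof.
elim: l => [|l IH] lL fg; first by rewrite !ml_approx0.
have Afg : A l f = A l g.
  by apply: IH => [|j jN]; [exact: ltnW|apply: fg; exact: leq_trans (N_le lL)].
rewrite !ml_approx_increment // Afg; congr (_ + _).
rewrite big_nat [RHS]big_nat; apply: eq_bigr => i /andP[_ iN].
by rewrite fg.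
Qed.

Lemma detail_vanishes (l j : nat) (a : nat -> R) : (l < L)%N -> (j < N l)%N ->
  (\sum_(N l <= i < N l.+1) a i *: chi l.+1 i) (x j) = 0.
Proof.
move=> lL jN; rewrite fct_sumE big_nat big1 // => i /andP[Ni iN].
rewrite scalrfctE chiE // ?(leq_trans jN) ?N_le //.
by rewrite gtn_eqF ?scaler0 // (leq_trans jN).
Qed.

Lemma detail_at_new_point (l j : nat) (a : nat -> R) : (l < L)%N ->
  (N l <= j < N l.+1)%N ->
  (\sum_(N l <= i < N l.+1) a i *: chi l.+1 i) (x j) = a j.
Proof.
move=> lL /andP[Nj jN]; rewrite fct_sumE.
rewrite (bigD1_seq j) ?mem_index_iota ?Nj ?iota_uniq //=.
rewrite big_seq_cond big1 => [|i]; last first.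
  rewrite mem_index_iota => /andP[/andP[_ iN] /negPf ij].
  by rewrite scalrfctE chiE // ij scaler0.
by rewrite addr0 scalrfctE chiE // eqxx /GRing.scale /= mulr1.
Qed.

(** Adding details of level [l.+1] to [A l f] leaves the values at the old
    points equal to those of [f], so [A l] cannot tell the sum from [f]; the
    residual is then exactly the added detail. *)
Lemma ml_approx_reproduces (l : nat) (f : Omega -> R) (a : nat -> R) :
  (l < L)%N ->
  let g := A l f + \sum_(N l <= i < N l.+1) a i *: chi l.+1 i in
  A l.+1 g = g.
Proof.
move=> lL g; have Ag : A l g = A l f.
  apply: ml_approx_local => [|j jN]; first exact: ltnW.
  by rewrite /g !fctE detail_vanishes // addr0 ml_approx_interpolates // ltnW.
rewrite ml_approx_increment // Ag {2}/g; congr (_ + _).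
rewrite big_nat [RHS]big_nat; apply: eq_bigr => i iN.
congr (_ *: _); rewrite -[RHS](detail_at_new_point a lL iN).
by rewrite /g fctE addrAC subrr add0r.
Qed.

Context (chi_continuous : forall l i, (1 <= l <= L)%N -> (i < N l)%N ->
  continuous (chi l i)).

Lemma continuous_ml_approx (l : nat) (f : Omega -> R) : (l <= L)%N ->
  continuous (A l f).
Proof.
elim: l => [|l IH] lL; first by rewrite ml_approx0; exact: cst_continuous.
rewrite ml_approxS => t; apply: (@continuousD _ _ Omega (A l f)).
  by apply: IH; exact: ltnW.
apply: (@continuous_fct_sum _ Omega _ (fun i => (f - A l f) (x i))) => i.
by rewrite mem_index_iota => iN; exact: chi_continuous.
Qed.

Lemma ml_space_direct_sum (l : nat) : (l < L)%N ->
  is_direct_sum (V l.+1) (V l) (lin_span (chi l.+1) (N l) (N l.+1)).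
Proof.
move=> lL; split.
- exact: ml_space_submod_closed.
- exact: lin_span_submod_closed.
- apply/seteqP; split=> [_ [f fc <-]|_ [_ [f fc <-]] [_ [a ->] <-]].
    exists (A l f); first by exists f.
    exists (\sum_(N l <= i < N l.+1) (f (x i) - A l f (x i)) *: chi l.+1 i).
      by exists (fun i => f (x i) - A l f (x i)).
    by rewrite ml_approx_increment.
  (* The sum serves as its own preimage under the operator of level [l.+1]. *)
  eexists; last exact: ml_approx_reproduces.
  move=> t; apply: (@continuousD _ _ Omega (A l f)).
    by apply: continuous_ml_approx; exact: ltnW.
  apply: (@continuous_fct_sum _ Omega) => i.
  by rewrite mem_index_iota => /andP[_ iN]; exact: chi_continuous.
- apply/seteqP; split=> [_ [[f fc <-] [a Afa]]|_ ->] /=.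
    rewrite -(ml_approx_at0 l); apply: ml_approx_local => [|j jN].
      exact: ltnW.
    by rewrite -(ml_approx_interpolates f (ltnW lL) jN) Afa detail_vanishes.
  split; first by exists 0; [exact: cst_continuous|exact: ml_approx_at0].
  by exists (fun=> 0); rewrite big1 // => i _; rewrite scale0r.
Qed.

Lemma ml_space0 : V 0 = [set 0].
Proof.
apply/seteqP; split=> [_ [f _ <-]|_ ->] /=; first exact: ml_approx0.
by exists 0; [exact: cst_continuous|exact: ml_approx0].
Qed.

End MultilevelOperator.

(** * The multilevel expansion and the direct sum *)

Theorem theorem3p9 (R : realType) (d : nat) (Omega : set 'rV[R]_d)
    (L : nat) (N : nat -> nat) (x : nat -> Omega) (mu c nu : R)
    (Phi : 'rV[R]_d -> R)
    (d_gt0 : (0 < d)%N)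
    (Omega_open : open Omega) (Omega_connected : connected Omega)
    (Omega_neq0 : Omega !=set0) (Omega_bounded : bounded_set Omega)
    (L_gt0 : (0 < L)%N)
    (N0 : N 0%N = 0%N) (N1_gt0 : (0 < N 1%N)%N)
    (x_distinct : forall l, (1 <= l <= L)%N -> {in `I_(N l) &, injective x})
    (X_nested : forall l, (1 <= l < L)%N ->
       point_set x (N l) `<=` point_set x (N l.+1))
    (mu_bounds : 0 < mu < 1) (c_bounds : 0 < c <= 1)
    (h_bounds : forall l, (1 <= l < L)%N ->
       c * mu * fill_distance (point_set x (N l))
         <= fill_distance (point_set x (N l.+1))
         <= mu * fill_distance (point_set x (N l)))
    (Phi_continuous : continuous Phi) (Phi_radial : radial Phi)
    (Phi_posdef : positive_definite Phi)
    (Phi_support : closure [set y | Phi y != 0] `<=` [set y | enorm y <= 1])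
    (nu_gt1 : 1 < nu) :
  let K := level_kernel Phi nu x N in
  let chi := fun l => cardinal_fun (K l) x (N l) in
  let A := ml_approx K x N in
  let V := ml_space K x N in
  [/\ forall f : Omega -> R, continuous f ->
        A L f = \sum_(1 <= l < L.+1) \sum_(N l.-1 <= i < N l)
                  (f (x i) - A l.-1 f (x i)) *: chi l i,
      L = 1%N -> V L = lin_span (chi 1%N) 0 (N 1%N) &
      (2 <= L)%N ->
        is_direct_sum (V L) (V L.-1) (lin_span (chi L) (N L.-1) (N L))].

Proof.
move=> K chi A V.
have N_le l : (l < L)%N -> (N l <= N l.+1)%N.
  case: l => [|l] lL; first by rewrite N0.
  by apply: (nested_size_le (x := x));
    [apply: x_distinct; rewrite (ltnW lL)|exact: X_nested].
have N_gt0 l : (1 <= l <= L)%N -> (0 < N l)%N.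
  case: l => // l /andP[_]; elim: l => [//|l IH] lL.
  exact: leq_trans (IH (ltnW lL)) (N_le _ lL).
have delta_gt0 l : (1 <= l <= L)%N ->
    0 < nu * fill_distance (point_set x (N l)).
  move=> lL; apply: mulr_gt0; first exact: lt_trans ltr01 nu_gt1.
  by apply: fill_distance_gt0 => //; exact: N_gt0.
have K_posdef l : (1 <= l <= L)%N -> positive_definite (K l).
  by move=> lL; apply: positive_definite_scaled => //; exact: delta_gt0.
have chiE l i j : (1 <= l <= L)%N -> (i < N l)%N -> (j < N l)%N ->
    chi l i (x j) = (i == j)%:R.
  move=> lL; apply: cardinal_funE; [exact: K_posdef|exact: x_distinct].
have chi_continuous l i : (1 <= l <= L)%N -> (i < N l)%N ->
    continuous (chi l i).
  move=> lL; apply: continuous_cardinal_fun; [exact: K_posdef|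
    exact: x_distinct|exact: continuous_scaled_kernel].
have sumV := ml_space_direct_sum chiE N0 N_le chi_continuous.
split=> [f _|L1|L2].
- exact: (ml_approx_expansion chiE N0 N_le).
- have := sumV 0%N L_gt0; rewrite N0 ml_space0 => -[_ _ V1E _].
  rewrite L1 /V V1E; apply/seteqP; split=> [_ [_ -> [u chiu <-]]|u chiu].
    by rewrite add0r.
  by exists 0 => //; exists u; rewrite ?add0r.
- by have := sumV L.-1; rewrite prednK //; apply.
Qed.
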